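(* Let $X$ be a nonempty finite or countably infinite set and let $\alpha=(\alpha_{xy})_{x,y\in X}$ be a matrix with nonnegative real entries. Assume that $w=(w_x)_{x\in X}$ is a vector with $w_x>0$ for all $x\in X$ and $\alpha w\le w$ (componentwise). Let $\Lambda\subseteq X$ and let $h_i\colon X\to[0,1]$ ($i\ge 1$) be functions with $0\le h_i\le\chi_\Lambda$ such that $$\sum_{i=1}^\infty h_i(x)=\infty\qquad\text{for all }x\in\Lambda .$$ If the nonnegative vector $c\in l^1(w)$ is such that $\|c(I_\Lambda\alpha I_\Lambda)^\ell\|_w\to 0$ as $\ell\to\infty$, then $$\|c(\beta_{h_1}\cdots\beta_{h_N}-\Pi_\Lambda)\|_w\;\longrightarrow\;0\qquad\text{as }N\to\infty .$$
   Context: Vectors $c$ multiply matrices from the left (row vectors), $w$ from the right. $\chi_\Lambda$ is the indicator function of $\Lambda$ and $\Lambda^c=X\setminus\Lambda$. For $f\colon X\to\mathbb R$, $I_f$ is the diagonal matrix $(I_f)_{xy}=f(x)\delta_{xy}$, and $I_\Lambda=I_{\chi_\Lambda}$. For $f\colon X\to[0,1]$ the cleaning operator is $\beta_f=I_{1-f}+I_f\alpha$. The balayage operator is $\Pi_\Lambda=\sum_{k=0}^\infty(I_\Lambda\alpha)^kI_{\Lambda^c}$ (entrywise sum of nonnegative terms; under the hypothesis $\alpha w\le w$ with $w>0$ its entries are finite). For a vector $c=(c_x)_{x\in X}$, $\|c\|_w=\sum_{x\in X}|c_x|w_x$, and $l^1(w)$ is the space of vectors with $\|c\|_w<\infty$.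 *)

(* Defs.v *)
From HB Require Import structures.
From mathcomp Require Import all_boot all_order all_algebra.
From mathcomp Require Import all_classical all_reals all_analysis.

Set Implicit Arguments.
Unset Strict Implicit.
Unset Printing Implicit Defensive.

Import Order.TTheory GRing.Theory Num.Theory.
Import numFieldNormedType.Exports.

Local Open Scope classical_set_scope.
Local Open Scope ring_scope.
Local Open Scope ereal_scope.

(* Vectors [X -> \bar R] and matrices [X -> X -> \bar R] have extended real
   entries, so that no infinite sum is silently truncated to a real number.
   [esum] is only meaningful for nonnegative families, hence the splitting into
   positive and negative parts: [xsum f] is the usual unordered sum whenever at
   most one of the two parts has an infinite sum. *)
Definition xsum (R : realType) (X : choiceType) (f : X -> \bar R) : \bar R :=
  \esum_(x in [set: X]) f^\+ x - \esum_(x in [set: X]) f^\- x.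

Definition xmul (R : realType) (X : choiceType) (A B : X -> X -> \bar R)
    : X -> X -> \bar R :=
  fun x y => xsum (fun z => A x z * B z y).

Definition xadd (R : realType) (X : choiceType) (A B : X -> X -> \bar R)
    : X -> X -> \bar R :=
  fun x y => A x y + B x y.

Definition xsub (R : realType) (X : choiceType) (A B : X -> X -> \bar R)
    : X -> X -> \bar R :=
  fun x y => A x y - B x y.

Definition xvec_mul (R : realType) (X : choiceType) (c : X -> \bar R)
    (A : X -> X -> \bar R) : X -> \bar R :=
  fun y => xsum (fun x => c x * A x y).

Definition xmul_vec (R : realType) (X : choiceType) (A : X -> X -> \bar R)
    (w : X -> \bar R) : X -> \bar R :=
  fun x => xsum (fun y => A x y * w y).

Definition xmx (R : realType) (X : choiceType) (A : X -> X -> R)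
    : X -> X -> \bar R :=
  fun x y => (A x y)%:E.

Definition xdiag (R : realType) (X : choiceType) (f : X -> R)
    : X -> X -> \bar R :=
  fun x y => (f x * (x == y)%:R)%:E.

Definition xdiag_set (R : realType) (X : choiceType) (L : set X)
    : X -> X -> \bar R :=
  xdiag (\1_L : X -> R).

Definition xid (R : realType) (X : choiceType) : X -> X -> \bar R :=
  xdiag (fun _ : X => 1%R : R).

Definition xpow (R : realType) (X : choiceType) (A : X -> X -> \bar R)
    (k : nat) : X -> X -> \bar R :=
  iter k (xmul A) (@xid R X).

Definition cleaning (R : realType) (X : choiceType) (alpha : X -> X -> R)
    (f : X -> R) : X -> X -> \bar R :=
  xadd (xdiag (fun x => 1 - f x)%R) (xmul (xdiag f) (xmx alpha)).

(* [cleanings alpha h N] is the product beta_{h_1} ... beta_{h_N}, in this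
   order; the value [h 0] is not used. *)
Definition cleanings (R : realType) (X : choiceType) (alpha : X -> X -> R)
    (h : nat -> X -> R) (N : nat) : X -> X -> \bar R :=
  \big[@xmul R X / @xid R X]_(1 <= i < N.+1) cleaning alpha (h i).

Definition balayage (R : realType) (X : choiceType) (alpha : X -> X -> R)
    (L : set X) : X -> X -> \bar R :=
  fun x y => \sum_(0 <= k <oo)
    xmul (xpow (xmul (xdiag_set R L) (xmx alpha)) k) (xdiag_set R (~` L)) x y.

Definition wnorm (R : realType) (X : choiceType) (w : X -> R)
    (c : X -> \bar R) : \bar R :=
  \esum_(x in [set: X]) (`|c x| * (w x)%:E).

(* Main.v *)
Require Import Defs.
From mathcomp Require Import all_boot all_order all_algebra.
From mathcomp Require Import all_classical all_reals all_analysis.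
From mathcomp Require Import lra.
Import Order.TTheory GRing.Theory Num.Theory.
Import numFieldNormedType.Exports.
Local Open Scope classical_set_scope.
Local Open Scope ring_scope.
Local Open Scope ereal_scope.

(** Write [s_N] for the vector [c] after [N] cleanings and [a_N] for its
    restriction to [Lambda], the mass that is still to be swept out.

    Cleaning inside [Lambda] does not change the balayage: the row of the
    balayage matrix at a point [x] of [Lambda] is the sum of its rows
    weighted by [alpha x], so [cleaning * balayage = balayage] and
    [c * balayage = s_N * balayage].  The rows outside [Lambda] are those of
    the identity.  Hence the error is [s_N - s_N * balayage = a_N - a_N * balayage], and its
    norm is at most twice that of [a_N], because [balayage w <= w]
    ([wnorm_residual]).  It remains to prove that the mass [<a_N, w>] tends to 0
    ([sandpile_cvg0]).

    With [T = I_Lambda alpha I_Lambda] one has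
    [a_(N+1) = a_N (1 - h) + (a_N h) T].  Let [H_N] be the sum of the moved
    masses [a_n h_(n+1)] for [n < N] (the odometer of a sandpile), so that
    [a_N + H_N = a_0 + H_N T].  Put [u_l = T^l w] and [v_l = u_l - u_(l+1)],
    which is nonnegative since [T w <= w], and satisfies [T v_l = v_(l+1)].
    Pairing the conservation law with [u_l] gives
    [<a_N, u_l> + <H_N, v_l> = <a_0, u_l>].  Three facts follow.
    - [<a_N, u_l>] is at most [<a_0, u_l>], which is small for large [l] by the
      hypothesis on [c T^l].
    - The total odometer [H] satisfies [<H, v_l> < oo], so [a_N] is dominated by
      [D = a_0 + H T] with [<D, v_l> = <a_0, v_l> + <H, v_(l+1)> < oo].
    - At a point with [D x < oo] the outflow [sum_n a_n(x) h_(n+1)(x)] is finite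
      while [sum_n h_n(x)] diverges, so [a_N(x)] tends to 0
      ([cvg0_divergent_rate]).

    By dominated convergence [<a_N, v_l>] tends to 0 for each [l], and
    [<a_N, w> = <a_N, u_L> + sum_(l < L) <a_N, v_l>] then tends to 0. *)

(** * Nonnegative vectors and matrices *)

Section Pairing.
Set Implicit Arguments.
Unset Strict Implicit.
Unset Printing Implicit Defensive.
Variables (R : realType) (X : choiceType).
Implicit Types (a b u v : X -> \bar R) (A B : X -> X -> \bar R).

(** The range of [k] includes [+oo]: the entries of a product of matrices are
    not known to be finite beforehand. *)
Lemma esumMr (T : choiceType) (a : T -> \bar R) (k : \bar R) :
  (forall x, 0 <= a x) -> 0 <= k ->
  \esum_(x in [set: T]) (a x * k) = (\esum_(x in [set: T]) a x) * k.
Proof.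
move=> a0 k0.
have scale_le (b : T -> \bar R) (r : \bar R) : (forall x, 0 <= b x) -> 0 <= r ->
    \esum_(x in [set: T]) (b x * r) <= (\esum_(x in [set: T]) b x) * r.
  move=> b0 r0; apply: ge_ereal_sup => _ [F [finF _] <-].
  rewrite -ge0_mule_fsuml//; apply: lee_wpmul2r => //.
  by apply: esum_ge; exists F.
apply/eqP; rewrite eq_le scale_le//=.
case: k k0 => [k||] // k0; last first.
  have [/esum1 ->|] := pselect (forall x, [set: T] x -> a x = 0).
    by rewrite mul0e; apply: esum_ge0 => x _; rewrite mule_ge0.
  move/existsNP => [x /not_implyP[_ /eqP ax]].
  rewrite (le_trans (leey _))//; apply: esum_ge; exists [set x] => //.
  by rewrite fsbig_set1 gt0_muley// lt0e ax a0.
have [->|k_neq0] := eqVneq k 0%R.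
  by rewrite mule0; apply: esum_ge0 => x _; rewrite mule0.
have k_gt0 : (0 < k)%R by rewrite lt0r k_neq0 -lee_fin.
rewrite -lee_pdivlMr//; apply: le_trans (scale_le _ _ _ _).
- by apply: le_esum => x _; rewrite -muleA -EFinM divff// mule1.
- by move=> x; rewrite mule_ge0.
- by rewrite lee_fin invr_ge0 ltW.
Qed.

Lemma esum_exchange (Y : choiceType) (F : X -> Y -> \bar R) :
  (forall x y, 0 <= F x y) ->
  \esum_(x in [set: X]) \esum_(y in [set: Y]) F x y =
  \esum_(y in [set: Y]) \esum_(x in [set: X]) F x y.
Proof.
move=> F0; rewrite !esum_esum//.
rewrite (reindex_esum ([set: Y] `*`` (fun=> [set: X])) _
  (fun p : Y * X => (p.2, p.1)))//.
split => //=; first by move=> [x y] [x' y'] _ _ [-> ->].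
by move=> [x y] _ /=; exists (y, x).
Qed.

Lemma esum_delta (y : X) a : (forall x, 0 <= a x) ->
  \esum_(x in [set: X]) (a x * (x == y)%:R%:E) = a y.
Proof.
move=> a0.
rewrite (esumID [set y]) => [|x _]; last by rewrite mule_ge0// lee_fin.
rewrite setTI esum_set1 ?eqxx ?mule1// esum1 ?adde0// => x [_ /= /eqP xy].
by rewrite (negbTE xy) mule0.
Qed.

(** Rows of matrices are vectors, so this one pairing expresses vector-matrix,
    matrix-vector and matrix-matrix products; on nonnegative families it
    replaces [xsum] and its splitting into signed parts. *)
Definition dot a u : \bar R := \esum_(x in [set: X]) (a x * u x).

Lemma xsumE a : (forall x, 0 <= a x) -> xsum a = \esum_(x in [set: X]) a x.
Proof.
move=> a0; rewrite /xsum [X in _ - X]esum1 => [|x _].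
  by rewrite sube0; apply: eq_esum => x _; rewrite funeposE; apply/max_idPl.
by rewrite funenegE; apply/max_idPr; rewrite leeNl oppe0.
Qed.

Lemma dot_ge0 a u : (forall x, 0 <= a x) -> (forall x, 0 <= u x) ->
  0 <= dot a u.
Proof. by move=> a0 u0; apply: esum_ge0 => x _; rewrite mule_ge0. Qed.

Lemma xsum_dot a u : (forall x, 0 <= a x) -> (forall x, 0 <= u x) ->
  xsum (fun x => a x * u x) = dot a u.
Proof. by move=> a0 u0; apply: xsumE => x; rewrite mule_ge0. Qed.

Lemma dotC a u : dot a u = dot u a.
Proof. by apply: eq_esum => x _; rewrite muleC. Qed.

Lemma eq_dot a b u v : a =1 b -> u =1 v -> dot a u = dot b v.
Proof. by move=> ab uv; apply: eq_esum => x _; rewrite ab uv. Qed.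

Lemma le_dot a b u v : (forall x, 0 <= a x) -> (forall x, 0 <= u x) ->
  (forall x, a x <= b x) -> (forall x, u x <= v x) -> dot a u <= dot b v.
Proof. by move=> a0 u0 ab uv; apply: le_esum => x _; apply: lee_pmul. Qed.

Lemma dotDr a u v : (forall x, 0 <= a x) -> (forall x, 0 <= u x) ->
  (forall x, 0 <= v x) -> dot a (fun x => u x + v x) = dot a u + dot a v.
Proof.
move=> a0 u0 v0; rewrite /dot -esumD; try by move=> *; exact: mule_ge0.
by apply: eq_esum => x _; rewrite ge0_muleDr.
Qed.

Lemma dotDl a b u : (forall x, 0 <= a x) -> (forall x, 0 <= b x) ->
  (forall x, 0 <= u x) -> dot (fun x => a x + b x) u = dot a u + dot b u.
Proof. by move=> a0 b0 u0; rewrite dotC dotDr// !(dotC u). Qed.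

Lemma dot_nneseries a (u : nat -> X -> \bar R) :
  (forall x, 0 <= a x) -> (forall k x, 0 <= u k x) ->
  dot a (fun x => \sum_(0 <= k <oo) u k x) = \sum_(0 <= k <oo) dot a (u k).
Proof.
move=> a0 u0; rewrite nneseries_esumT => [|k]; last exact: dot_ge0.
rewrite /dot -esum_exchange => [|x k]; last by rewrite mule_ge0.
apply: eq_esum => x _; rewrite nneseries_esumT// [LHS]muleC -esumMr//.
by apply: eq_esum => k _; rewrite muleC.
Qed.

Lemma dot_sum a (u : nat -> X -> \bar R) n :
  (forall x, 0 <= a x) -> (forall k x, 0 <= u k x) ->
  dot a (fun x => \sum_(0 <= k < n) u k x) = \sum_(0 <= k < n) dot a (u k).
Proof.
move=> a0 u0; rewrite /dot -esum_sum => [|x k _ _]; last by rewrite mule_ge0.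
by apply: eq_esum => x _; rewrite ge0_sume_distrr.
Qed.

(** Tonelli: the associativity of [a A u], from which that of all the products
    below is deduced. *)
Lemma dotA a A u : (forall x, 0 <= a x) -> (forall x y, 0 <= A x y) ->
  (forall x, 0 <= u x) ->
  dot (fun y => dot a (A^~ y)) u = dot a (fun x => dot (A x) u).
Proof.
move=> a0 A0 u0; rewrite /dot.
transitivity (\esum_(y in [set: X]) \esum_(x in [set: X]) (a x * A x y * u y)).
  by apply: eq_esum => y _; rewrite esumMr// => x; rewrite mule_ge0.
rewrite -esum_exchange => [|x y]; last by rewrite !mule_ge0.
apply: eq_esum => x _; rewrite [RHS]muleC -esumMr//; last first.
  by move=> y; rewrite mule_ge0.
by apply: eq_esum => y _; rewrite -[LHS]muleA [LHS]muleC.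
Qed.

Lemma dot_diagr (y : X) a (f : X -> R) : (forall x, 0 <= a x) ->
  (forall x, 0 <= f x)%R -> dot a (xdiag f ^~ y) = a y * (f y)%:E.
Proof.
move=> a0 f0; rewrite -(@esum_delta y (fun x => a x * (f x)%:E)) => [|x].
  by apply: eq_esum => x _; rewrite /xdiag EFinM muleA.
by rewrite mule_ge0// lee_fin.
Qed.

Lemma dot_diagl (x : X) u (f : X -> R) : (forall x, 0 <= u x) ->
  (forall x, 0 <= f x)%R -> dot (xdiag f x) u = (f x)%:E * u x.
Proof.
move=> u0 f0; rewrite muleC -dot_diagr// dotC; apply: eq_dot => // y.
by rewrite /xdiag eq_sym; case: eqVneq => [->|]; rewrite ?mulr0.
Qed.

Lemma xdiag_ge0 (f : X -> R) : (forall x, 0 <= f x)%R ->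
  forall x y, 0 <= xdiag f x y.
Proof. by move=> f0 x y; rewrite lee_fin mulr_ge0. Qed.

Lemma xmul_ge0 A B : (forall x y, 0 <= A x y) -> (forall x y, 0 <= B x y) ->
  forall x y, 0 <= xmul A B x y.
Proof. by move=> A0 B0 x y; rewrite /xmul xsum_dot// dot_ge0. Qed.

Lemma xmulE A B x y : (forall x y, 0 <= A x y) -> (forall x y, 0 <= B x y) ->
  xmul A B x y = dot (A x) (B^~ y).
Proof. by move=> A0 B0; rewrite /xmul xsum_dot. Qed.

Lemma xpow_ge0 A k : (forall x y, 0 <= A x y) -> forall x y, 0 <= xpow A k x y.
Proof.
move=> A0; elim: k => [|k IH]; last exact: xmul_ge0.
by apply: xdiag_ge0 => x.
Qed.

Lemma dot_xmul A B x u : (forall x y, 0 <= A x y) -> (forall x y, 0 <= B x y) ->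
  (forall x, 0 <= u x) -> dot (xmul A B x) u = dot (A x) (fun y => dot (B y) u).
Proof.
move=> A0 B0 u0; rewrite -dotA//.
by apply: eq_dot => // y; rewrite xmulE.
Qed.

Lemma xvec_mulE a A : (forall x, 0 <= a x) -> (forall x y, 0 <= A x y) ->
  forall y, xvec_mul a A y = dot a (A^~ y).
Proof. by move=> a0 A0 y; rewrite /xvec_mul xsum_dot. Qed.

Lemma xvec_mul_ge0 a A : (forall x, 0 <= a x) -> (forall x y, 0 <= A x y) ->
  forall y, 0 <= xvec_mul a A y.
Proof. by move=> a0 A0 y; rewrite xvec_mulE// dot_ge0. Qed.

Lemma xvec_mul_xmul a A B : (forall x, 0 <= a x) ->
  (forall x y, 0 <= A x y) -> (forall x y, 0 <= B x y) ->
  xvec_mul a (xmul A B) = xvec_mul (xvec_mul a A) B.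
Proof.
move=> a0 A0 B0; apply/funext => y.
rewrite !xvec_mulE//; [|exact: xvec_mul_ge0|exact: xmul_ge0].
rewrite (eq_dot (xvec_mulE a0 A0) (frefl _)) dotA//.
by apply: eq_dot => // x; rewrite xmulE.
Qed.

End Pairing.

(** * Limits of sequences and sums *)

Section Convergence.
Set Implicit Arguments.
Unset Strict Implicit.
Unset Printing Implicit Defensive.
Variable R : realType.

Lemma cvge0P (f : nat -> \bar R) : (forall n, 0 <= f n) ->
  f @ \oo --> 0 <-> forall e : R, (0 < e)%R -> \forall n \near \oo, f n <= e%:E.
Proof.
move=> f0; split=> [/fine_cvgP[ffin fcvg] e e0|f_le].
  move/cvgrPdist_le : fcvg => /(_ e e0).
  apply: filterS2 ffin => n fn; rewrite sub0r normrN /=.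
  by rewrite ger0_norm ?fine_ge0// -lee_fin fineK.
apply/fine_cvgP; split.
  apply: filterS (f_le 1%R ltr01) => n fn1.
  by rewrite ge0_fin_numE// (le_lt_trans fn1)// ltry.
apply/cvgrPdist_le => e e0; apply: filterS (f_le e e0) => n fne.
rewrite sub0r normrN /= ger0_norm ?fine_ge0// -lee_fin fineK//.
by rewrite ge0_fin_numE// (le_lt_trans fne)// ltry.
Qed.

(** Dominated convergence for unordered sums: outside a finite set the majorant
    sums to at most [e / 2], and on it the limit is taken termwise. *)
Lemma dominated_esum (X : choiceType) (f : nat -> X -> \bar R)
    (F : X -> \bar R) :
  (forall n x, 0 <= f n x) -> (forall n x, f n x <= F x) ->
  \esum_(x in [set: X]) F x < +oo -> (forall x, f ^~ x @ \oo --> 0) ->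
  (fun n => \esum_(x in [set: X]) f n x) @ \oo --> 0.
Proof.
move=> f0 fF Foo fcvg.
have F0 x : 0 <= F x by rewrite (le_trans _ (fF 0%N x)).
apply/cvge0P => [n|e e0]; first exact: esum_ge0.
have e20 : (0 < e / 2)%R by rewrite divr_gt0.
have Ffin : \esum_(x in [set: X]) F x \is a fin_num.
  by rewrite ge0_fin_numE// esum_ge0.
have [_ [A [finA _] <-] FA] := ub_ereal_sup_adherent e20 Ffin.
have tailF : \esum_(x in ~` A) F x <= (e / 2)%:E.
  move: FA Ffin; rewrite -/(esum _ _) (esumID A)// !setTI.
  rewrite (esum_fset finA)// fin_numD => /[swap] /andP[Afin ?].
  by rewrite lteBlDr// lteD2lE// => /ltW.
have headf : (fun n => \sum_(x \in A) f n x) @ \oo --> 0.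
  have -> : (fun n => \sum_(x \in A) f n x) =
      (fun n => \sum_(x <- finmap.enum_fset (fset_set A)) f n x).
    by apply/funext => n; rewrite fsbig_finite.
  rewrite [X in _ --> X](_ : _ =
      \sum_(x <- finmap.enum_fset (fset_set A)) (0 : \bar R)).
    by apply: cvg_nnesum => x _; [apply: nearW|exact: fcvg].
  by rewrite big1.
have headf0 n : 0 <= \sum_(x \in A) f n x by exact: fsume_ge0.
apply: filterS ((cvge0P headf0).1 headf _ e20) => n fnA.
rewrite (esumID A)// !setTI (esum_fset finA)// (splitr e) EFinD.
by apply: leeD fnA (le_trans _ tailF); apply: le_esum => x _.
Qed.

(** One site of the sandpile: [b n] is its content, [b n * g n] what leaves it
    at step [n], and [J n] the initial content plus what has entered it.  Both
    [J] and the total outflow are bounded and nondecreasing, so their difference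
    [b] converges; a positive limit would make the outflow comparable with the
    divergent sum of the rates. *)
Lemma cvg0_divergent_rate (b g J : nat -> R) (C : R) :
  (forall n, 0 <= b n)%R -> (forall n, 0 <= g n)%R ->
  nondecreasing_seq J -> (forall n, J n <= C)%R ->
  (forall n, b n + \sum_(0 <= k < n) b k * g k = J n)%R ->
  \sum_(0 <= k <oo) (g k)%:E = +oo ->
  b @ \oo --> (0 : R)%R.
Proof.
move=> b0 g0 Jnd JC bJ gy.
pose S n := (\sum_(0 <= k < n) b k * g k)%R.
have Snd : nondecreasing_seq S.
  by apply/nondecreasing_seqP => n; rewrite /S big_nat_recr//= lerDl mulr_ge0.
have SC n : (S n <= C)%R by rewrite (le_trans _ (JC n))// -bJ lerDr.
have Scvg : cvgn S.
  by apply: nondecreasing_is_cvgn => //; exists C => _ [n _ <-].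
have Jcvg : cvgn J.
  by apply: nondecreasing_is_cvgn => //; exists C => _ [n _ <-].
have bE : b = (fun n => J n - S n)%R by apply/funext => n; rewrite -bJ addrK.
have bcvg : b @ \oo --> (limn J - limn S)%R by rewrite bE; exact: cvgB.
set l := (limn J - limn S)%R in bcvg.
have l0 : (0 <= l)%R.
  by rewrite -(cvg_lim _ bcvg)//; apply: limr_ge;
    [apply/cvg_ex; exists l|apply: nearW].
have [<-//|l_neq0] := eqVneq l 0%R.
have l_gt0 : (0 < l)%R by rewrite lt0r l_neq0.
have [K _ bK] : \forall n \near \oo, (l / 2 <= b n)%R.
  have /cvgrPdist_le/(_ (l / 2)%R) := bcvg; rewrite divr_gt0// => /(_ isT).
  apply: filterS => n /ler_normlP[_]; lra.
have : \sum_(0 <= k <oo) (g k)%:E <=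
    (\sum_(0 <= k < K) g k + C / (l / 2))%:E.
  apply: lime_le; first by apply: is_cvg_nneseries => n _ _; rewrite lee_fin.
  near=> n; rewrite sumEFin lee_fin.
  have Kn : (K <= n)%N by near: n; exists K.
  rewrite (big_cat_nat (leq0n K) Kn)/= lerD2l ler_pdivlMr ?divr_gt0//.
  rewrite (le_trans _ (SC n))// /S (big_cat_nat (leq0n K) Kn)/=.
  rewrite -[leLHS]add0r lerD ?sumr_ge0// => [i _|]; first by rewrite mulr_ge0.
  rewrite mulr_suml [leLHS]big_nat [leRHS]big_nat.
  apply: ler_sum => i /andP[Ki _].
  by rewrite mulrC ler_wpM2r// bK.
by rewrite gy leye_eq.
Unshelve. all: by end_near. Qed.

End Convergence.

(** * Decay of the mass of a sandpile *)

Section Potential.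
Set Implicit Arguments.
Unset Strict Implicit.
Unset Printing Implicit Defensive.
Variables (R : realType) (X : choiceType).
Variables (T : X -> X -> \bar R) (w : X -> R).
Hypothesis T0 : forall x y, 0 <= T x y.
Hypothesis w0 : forall x, (0 <= w x)%R.

Definition potential l : X -> \bar R :=
  iter l (fun v x => dot (T x) v) (EFin \o w).

Lemma potential_ge0 l x : 0 <= potential l x.
Proof.
by elim: l x => [|l IH] x; [rewrite lee_fin|exact: (dot_ge0 (T0 x) IH)].
Qed.

Lemma dot_xpow l x : dot (xpow T l x) (EFin \o w) = potential l x.
Proof.
have w0' y : 0 <= (EFin \o w) y by rewrite lee_fin.
elim: l x => [|l IH] x; first by rewrite dot_diagl// mul1e.
by rewrite dot_xmul//; [exact: eq_dot|exact: xpow_ge0].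
Qed.

End Potential.

Section Sandpile.
Set Implicit Arguments.
Unset Strict Implicit.
Unset Printing Implicit Defensive.
Variables (R : realType) (X : choiceType).
Variables (T : X -> X -> \bar R) (w : X -> R).
Hypothesis T0 : forall x y, 0 <= T x y.
Hypothesis w0 : forall x, (0 <= w x)%R.
Hypothesis Tw : forall x, dot (T x) (EFin \o w) <= (w x)%:E.
Variables (g : nat -> X -> R) (a : nat -> X -> \bar R).
Hypothesis g01 : forall n x, (0 <= g n x <= 1)%R.
Hypothesis a_ge0 : forall n x, 0 <= a n x.

Let m n x := a n x * (g n x)%:E.

Hypothesis a_rec : forall n y,
  a n.+1 y = a n y * (1 - g n y)%:E + dot (m n) (T^~ y).
Hypothesis mass : dot (a 0) (EFin \o w) < +oo.

Let u := potential T w.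
Let v l x := u l x - u l.+1 x.
Let H n x := \sum_(0 <= k < n) m k x.
Let Hoo x := \sum_(0 <= k <oo) m k x.

Let m_ge0 n x : 0 <= m n x.
Proof. by rewrite mule_ge0// lee_fin; case/andP: (g01 n x). Qed.

Let H_ge0 n x : 0 <= H n x. Proof. exact: sume_ge0. Qed.

Let Hoo_ge0 x : 0 <= Hoo x. Proof. exact: nneseries_ge0. Qed.

Let le_H_Hoo n x : H n x <= Hoo x. Proof. exact: nneseries_lim_ge. Qed.

Let u_ge0 l x : 0 <= u l x.
Proof. exact: potential_ge0. Qed.

Let u_nincr l x : u l.+1 x <= u l x.
Proof.
elim: l x => [|l IH] x; first exact: Tw.
exact: (le_dot (T0 x) (u_ge0 _) (fun=> lexx _) IH).
Qed.

Let u_le_w l x : u l x <= (w x)%:E.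
Proof.
by elim: l => [|l]; [rewrite /u /= lexx|exact: le_trans (u_nincr l x)].
Qed.

Let u_fin l x : u l x \is a fin_num.
Proof. by rewrite ge0_fin_numE// (le_lt_trans (u_le_w l x))// ltry. Qed.

Let v_ge0 l x : 0 <= v l x.
Proof. by rewrite /v sube_ge0 ?u_nincr// u_fin. Qed.

Let v_fin l x : v l x \is a fin_num.
Proof. by rewrite fin_numB !u_fin. Qed.

Let u_split l x : u l x = u l.+1 x + v l x.
Proof. by rewrite /v addeC subeK. Qed.

Let T_v l x : dot (T x) (v l) = v l.+1 x.
Proof.
have : u l.+1 x = u l.+2 x + dot (T x) (v l).
  rewrite -[u l.+1 x]/(dot (T x) (u l)) -[u l.+2 x]/(dot (T x) (u l.+1)).
  by rewrite (eq_dot (frefl _) (u_split l)) dotDr.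
by move=> E; rewrite [RHS]/v E [u l.+2 x + _]addeC addeK.
Qed.

Let a_split n x : a n x = a n x * (1 - g n x)%:E + m n x.
Proof.
case/andP: (g01 n x) => g0 g1.
by rewrite /m -ge0_muleDr ?lee_fin ?subr_ge0// -EFinD subrK mule1.
Qed.

Let a_step n y : a n.+1 y + m n y = a n y + dot (m n) (T^~ y).
Proof. by rewrite a_rec [in RHS]a_split addeAC. Qed.

(** Conservation of mass at [y], summed over the first [n] steps. *)
Let sandpile n y : a n y + H n y = a 0 y + dot (H n) (T^~ y).
Proof.
elim: n => [|n IH].
  by rewrite /H big_geq// [dot _ _]esum1// => x _; rewrite big_geq// mul0e.
have HS x : H n.+1 x = H n x + m n x by rewrite /H big_nat_recr.
rewrite (eq_dot HS (frefl _)) dotDl// addeA -IH HS addeCA addeAC a_step.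
exact: addeC.
Qed.

Let sandpile_dot n z : (forall x, 0 <= z x) ->
  dot (a n) z + dot (H n) z = dot (a 0) z + dot (H n) (fun x => dot (T x) z).
Proof.
move=> z0; rewrite -dotA// -!dotDl// => [|x]; last exact: dot_ge0.
by apply: eq_dot => // y; rewrite sandpile.
Qed.

Let dot_a_step n : dot (a n.+1) (EFin \o w) <= dot (a n) (EFin \o w).
Proof.
have w0' x : 0 <= (EFin \o w) x by rewrite lee_fin.
have Tv x : 0 <= dot (T x) (EFin \o w) by exact: dot_ge0.
rewrite (eq_dot (a_rec n) (frefl _)) (eq_dot (a_split n) (frefl _)).
have r0 x : 0 <= a n x * (1 - g n x)%:E.
  by rewrite mule_ge0// lee_fin subr_ge0; case/andP: (g01 n x).
rewrite !dotDl// => [|x]; last exact: dot_ge0.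
by rewrite leeD2l// dotA// le_dot.
Qed.

Let dot_a_fin n : dot (a n) (EFin \o w) < +oo.
Proof. by elim: n => // n; exact: le_lt_trans. Qed.

Let dot_H_u_fin n l : dot (H n) (u l) \is a fin_num.
Proof.
rewrite ge0_fin_numE ?dot_ge0// /H dotC dot_sum//; apply: lte_sum_pinfty => k _.
rewrite (le_lt_trans _ (dot_a_fin k))// dotC le_dot// => x.
rewrite [leRHS]a_split leeDr// mule_ge0// lee_fin subr_ge0.
by case/andP: (g01 k x).
Qed.

(** The term [dot (H n) (u l.+1)] appears on both sides of the conservation law
    paired with [u l], and cancels because it is finite. *)
Let balance n l : dot (a n) (u l) + dot (H n) (v l) = dot (a 0) (u l).
Proof.
have := sandpile_dot n (u_ge0 l).
rewrite -[fun x => dot (T x) (u l)]/(u l.+1).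
rewrite (eq_dot (frefl (H n)) (u_split l)) dotDr// addeA addeAC.
by move/(congr1 (fun z => z - dot (H n) (u l.+1))); rewrite !addeK.
Qed.

Let dot_a_u n l : dot (a n) (u l) <= dot (a 0) (u l).
Proof. by rewrite -(balance n l) leeDl// dot_ge0. Qed.

Let dot_Hoo_v l : dot Hoo (v l) < +oo.
Proof.
rewrite (le_lt_trans _ mass)// dotC dot_nneseries//; apply: lime_le.
  by apply: is_cvg_nneseries => k _ _; exact: dot_ge0.
apply: nearW => n; rewrite -dot_sum// dotC.
have au_w : dot (a 0) (u l) <= dot (a 0) (EFin \o w) by exact: le_dot.
by apply: le_trans au_w; rewrite -(balance n l) leeDr// dot_ge0.
Qed.

Let D y := a 0 y + dot Hoo (T^~ y).

Let D_ge0 y : 0 <= D y. Proof. by rewrite adde_ge0// dot_ge0. Qed.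

Let a_H_le_D n y : a n y + H n y <= D y.
Proof. by rewrite sandpile leeD2l// le_dot. Qed.

Let a_le_D n y : a n y <= D y.
Proof. by rewrite (le_trans _ (a_H_le_D n y))// leeDl. Qed.

(** Moving [T] to the other side of the pairing turns [v l] into [v l.+1], so
    the bound on [dot Hoo] at the next level controls the inflow. *)
Let dot_D_v l : dot D (v l) < +oo.
Proof.
rewrite dotDl// => [|y]; last exact: dot_ge0.
rewrite dotA// (eq_dot (frefl Hoo) (T_v l)) lte_add_pinfty//.
apply: le_lt_trans mass; apply: le_dot => // x.
by rewrite (le_trans _ (u_le_w l x))// [leRHS]u_split leeDr.
Qed.

(** Sites with summable rates are admitted provided that they stay empty: such
    are the sites outside the set that is swept. *)
Hypothesis g_div : forall x,
  (forall n, a n x = 0) \/ \sum_(0 <= k <oo) (g k x)%:E = +oo.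

(** Finiteness of the majorant [D x] bounds the content, the inflow and the
    outflow at [x], which can then be handled as real sequences. *)
Let a_cvg0 x : D x < +oo -> a ^~ x @ \oo --> 0.
Proof.
move=> Dx; have [az|gy] := g_div x.
  by rewrite (_ : a ^~ x = cst 0) ?funeqE//; exact: cvg_cst.
have fin_le_D z : 0 <= z -> z <= D x -> z \is a fin_num.
  by move=> z0 zD; rewrite ge0_fin_numE// (le_lt_trans zD).
have afin n : a n x \is a fin_num by exact: fin_le_D.
have Dfin : D x \is a fin_num by exact: fin_le_D.
have mE n : m n x = (fine (a n x) * g n x)%:E by rewrite EFinM fineK.
have HE n : H n x = (\sum_(0 <= k < n) fine (a k x) * g k x)%:E.
  by rewrite -sumEFin; apply: eq_bigr.
have aHE n : a n x + H n x =
    (fine (a n x) + \sum_(0 <= k < n) fine (a k x) * g k x)%:E.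
  by rewrite EFinD fineK// HE.
apply/fine_cvgP; split; first exact: nearW.
apply: (@cvg0_divergent_rate _ _ (g ^~ x)
  (fun n => fine (a n x) + \sum_(0 <= k < n) fine (a k x) * g k x)%R
  (fine (D x))) => //.
- by move=> n; exact: fine_ge0.
- by move=> n; case/andP: (g01 n x).
- apply/nondecreasing_seqP => n; rewrite -lee_fin -!aHE !sandpile leeD2l//.
  by rewrite le_dot// => y; rewrite /H big_nat_recr//= leeDl.
- by move=> n; rewrite -lee_fin -aHE fineK.
Qed.

Let dot_a_v_cvg0 l : (fun n => dot (a n) (v l)) @ \oo --> 0.
Proof.
apply: (dominated_esum _ _ (dot_D_v l)) => [n x|n x|x]; first exact: mule_ge0.
  by rewrite lee_wpmul2r.
(* Where [v l] vanishes the majorant [D] may be infinite, and [a] need not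
   tend to 0. *)
have [->|vx] := eqVneq (v l x) 0.
  by under eq_fun do rewrite mule0; exact: cvg_cst.
rewrite -[X in _ --> X](mul0e (v l x)); apply: cvgeZr => //; apply: a_cvg0.
have Dv : D x * v l x < +oo.
  rewrite (le_lt_trans _ (dot_D_v l))//; apply: esum_ge; exists [set x] => //.
  by rewrite fsbig_set1.
rewrite ltey; apply: contraTneq Dv => ->.
by rewrite gt0_mulye ?ltxx// lt0e vx v_ge0.
Qed.

Let dot_a_telescope n L :
  dot (a n) (EFin \o w) = dot (a n) (u L) + \sum_(0 <= l < L) dot (a n) (v l).
Proof.
elim: L => [|L IH]; first by rewrite big_geq// adde0.
rewrite IH (eq_dot (frefl (a n)) (u_split L)) dotDr// big_nat_recr//=.
by rewrite -addeA [dot _ (v L) + _]addeC.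
Qed.

(** The mass at time [n] is the mass that will survive [L] more steps of [T],
    small uniformly in [n] by the hypothesis on [a 0], plus finitely many terms
    [dot (a n) (v l)], each of which tends to 0. *)
Lemma sandpile_cvg0 : (fun l => dot (a 0) (potential T w l)) @ \oo --> 0 ->
  (fun n => dot (a n) (EFin \o w)) @ \oo --> 0.
Proof.
have au0 l : 0 <= dot (a 0) (potential T w l) by exact: dot_ge0.
move=> /(cvge0P au0) tail; apply/cvge0P => [n|e e0].
  by rewrite dot_ge0// => x; rewrite lee_fin.
have e20 : (0 < e / 2)%R by rewrite divr_gt0.
have [L _ /(_ L (leqnn L)) aL] := tail _ e20.
have sum0 : (fun n => \sum_(0 <= l < L) dot (a n) (v l)) @ \oo --> 0.
  rewrite [X in _ --> X](_ : _ = \sum_(0 <= l < L) (0 : \bar R)); last first.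
    by rewrite big1.
  apply: cvg_nnesum => l _; last exact: dot_a_v_cvg0.
  by apply: nearW => n; exact: dot_ge0.
have sum_ge0 n : 0 <= \sum_(0 <= l < L) dot (a n) (v l).
  by apply: sume_ge0 => l _; exact: dot_ge0.
apply: filterS ((cvge0P sum_ge0).1 sum0 _ e20) => n sum_le.
rewrite (dot_a_telescope n L) (splitr e) EFinD leeD//.
exact: le_trans (dot_a_u n L) aL.
Qed.

End Sandpile.

(** * Cleaning and balayage operators *)

Section Cleaning.
Set Implicit Arguments.
Unset Strict Implicit.
Unset Printing Implicit Defensive.
Variables (R : realType) (X : choiceType) (alpha : X -> X -> R).
Hypothesis alpha_ge0 : forall x y, (0 <= alpha x y)%R.

Let alpha0 x y : 0 <= xmx alpha x y. Proof. by rewrite lee_fin. Qed.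

Lemma xmul_diagl (f : X -> R) (A : X -> X -> \bar R) x y :
  (forall x, 0 <= f x)%R -> (forall x y, 0 <= A x y) ->
  xmul (xdiag f) A x y = (f x)%:E * A x y.
Proof. by move=> f0 A0; rewrite xmulE ?dot_diagl//; exact: xdiag_ge0. Qed.

Lemma xmul_diagr (f : X -> R) (A : X -> X -> \bar R) x y :
  (forall x, 0 <= f x)%R -> (forall x y, 0 <= A x y) ->
  xmul A (xdiag f) x y = A x y * (f y)%:E.
Proof. by move=> f0 A0; rewrite xmulE ?dot_diagr//; exact: xdiag_ge0. Qed.

Section SingleCleaning.
Variable f : X -> R.
Hypothesis f01 : forall x, (0 <= f x <= 1)%R.

Let f0 x : (0 <= f x)%R. Proof. by case/andP: (f01 x). Qed.
Let f1 x : (0 <= 1 - f x)%R.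
Proof. by rewrite subr_ge0; case/andP: (f01 x). Qed.
Let fa x y : 0 <= xmul (xdiag f) (xmx alpha) x y.
Proof. by apply: xmul_ge0 => // ? ?; exact: xdiag_ge0. Qed.

Lemma cleaning_ge0 x y : 0 <= cleaning alpha f x y.
Proof. by rewrite adde_ge0//; exact: xdiag_ge0. Qed.

Lemma dot_cleaning x u : (forall y, 0 <= u y) ->
  dot (cleaning alpha f x) u =
  (1 - f x)%:E * u x + (f x)%:E * dot (xmx alpha x) u.
Proof.
move=> u0; rewrite dotDl//; last exact: xdiag_ge0.
rewrite dot_diagl// dot_xmul//; last exact: xdiag_ge0.
by rewrite dot_diagl// => y; exact: dot_ge0.
Qed.

Lemma xvec_mul_cleaning c y : (forall x, 0 <= c x) ->
  xvec_mul c (cleaning alpha f) y =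
  c y * (1 - f y)%:E + dot (fun x => c x * (f x)%:E) (xmx alpha ^~ y).
Proof.
move=> c0; rewrite xvec_mulE//; last exact: cleaning_ge0.
rewrite dotDr//; last by move=> x; exact: xdiag_ge0.
rewrite dot_diagr//; congr (_ + _); apply: eq_esum => x _.
by rewrite xmul_diagl// muleA.
Qed.
End SingleCleaning.

Variable h : nat -> X -> R.
Hypothesis h01 : forall i x, (1 <= i)%N -> (0 <= h i x <= 1)%R.

Fixpoint swept (c : X -> \bar R) n : X -> \bar R :=
  if n is m.+1 then xvec_mul (swept c m) (cleaning alpha (h m.+1)) else c.

Lemma swept_ge0 c n : (forall x, 0 <= c x) -> forall x, 0 <= swept c n x.
Proof.
move=> c0; elim: n => //= n IH; apply: xvec_mul_ge0 => //.
by apply: cleaning_ge0 => x; exact: h01.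
Qed.

Lemma big_xmul_ge0 (s : seq nat) : (forall i, i \in s -> (1 <= i)%N) ->
  forall x y,
    0 <= (\big[@xmul R X / @xid R X]_(i <- s) cleaning alpha (h i)) x y.
Proof.
elim: s => [_|i s IH s1] x y; first by rewrite big_nil; exact: xdiag_ge0.
rewrite big_cons; apply: xmul_ge0 => [|].
  by apply: cleaning_ge0 => z; apply: h01; rewrite s1 ?mem_head.
by apply: IH => j js; rewrite s1// inE js orbT.
Qed.

Lemma cleanings_ge0 n x y : 0 <= cleanings alpha h n x y.
Proof. by apply: big_xmul_ge0 => i; rewrite mem_index_iota => /andP[]. Qed.

(** The product of the cleanings is nested to the right, whereas [swept] acts
    from the left.  As [xmul] is associative on nonnegative matrices but is not
    a monoid law, the factors are moved across by induction on their list. *)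
Lemma xvec_mul_cleanings c n : (forall x, 0 <= c x) ->
  xvec_mul c (cleanings alpha h n) = swept c n.
Proof.
have xvec_mul_big (s : seq nat) d : (forall i, i \in s -> (1 <= i)%N) ->
    (forall x, 0 <= d x) ->
    xvec_mul d (\big[@xmul R X / @xid R X]_(i <- s) cleaning alpha (h i)) =
    foldl (fun e i => xvec_mul e (cleaning alpha (h i))) d s.
  elim: s d => [|i s IH] d s1 d0 /=.
    rewrite big_nil; apply/funext => y.
    rewrite xvec_mulE//; last exact: xdiag_ge0.
    by rewrite dot_diagr// mule1.
  have hi z : (0 <= h i z <= 1)%R by apply: h01; rewrite s1 ?mem_head.
  have s1' j : j \in s -> (1 <= j)%N by move=> js; rewrite s1// inE js orbT.
  have bi := cleaning_ge0 hi.
  rewrite big_cons xvec_mul_xmul//; last exact: big_xmul_ge0.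
  by rewrite IH//; exact: xvec_mul_ge0.
move=> c0; rewrite xvec_mul_big//; last first.
  by move=> i; rewrite mem_index_iota => /andP[].
rewrite /index_iota subSS subn0; elim: n => // n IH; rewrite [RHS]/= -IH.
have -> : iota 1 n.+1 = rcons (iota 1 n) n.+1.
  by rewrite -[in LHS](addn1 n) iotaD cats1 add1n.
by rewrite foldl_rcons.
Qed.

Section Balayage.
Variable L : set X.

Let ind0 x : (0 <= \1_L x :> R)%R. Proof. by rewrite indicE. Qed.
Let indC0 x : (0 <= \1_(~` L) x :> R)%R. Proof. by rewrite indicE. Qed.

Let ind_in x : L x -> (\1_L x = 1 :> R)%R /\ (\1_(~` L) x = 0 :> R)%R.
Proof. by move=> Lx; rewrite !indicE in_setC mem_set. Qed.

Let ind_out x : ~ L x -> (\1_L x = 0 :> R)%R /\ (\1_(~` L) x = 1 :> R)%R.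
Proof. by move=> Lx; rewrite !indicE in_setC memNset. Qed.

Let P := xmul (xdiag_set R L) (xmx alpha).
Let J := xdiag_set R (~` L).
Let Q k := xmul (xpow P k) J.

Let P_ge0 x y : 0 <= P x y.
Proof. by apply: xmul_ge0 => // ? ?; exact: xdiag_ge0. Qed.
Let J_ge0 x y : 0 <= J x y. Proof. exact: xdiag_ge0. Qed.
Let Q_ge0 k x y : 0 <= Q k x y.
Proof. by apply: xmul_ge0 => //; exact: xpow_ge0. Qed.

Let dot_P x u : (forall y, 0 <= u y) ->
  dot (P x) u = (\1_L x)%:E * dot (xmx alpha x) u.
Proof.
move=> u0; rewrite dot_xmul//; last exact: xdiag_ge0.
by rewrite dot_diagl// => y; exact: dot_ge0.
Qed.

Let Q0 x y : Q 0 x y = J x y.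
Proof. by rewrite /Q xmul_diagl ?mul1e. Qed.

Let QS k x y : Q k.+1 x y = dot (P x) (Q k ^~ y).
Proof.
rewrite /Q xmulE// => [|? ?]; last exact: xpow_ge0.
rewrite dot_xmul// => [|? ?]; last exact: xpow_ge0.
by apply: eq_dot => // z; rewrite xmulE// => ? ?; exact: xpow_ge0.
Qed.

Lemma balayage_ge0 x y : 0 <= balayage alpha L x y.
Proof. by apply: nneseries_ge0 => k _ _; exact: Q_ge0. Qed.

(** The first term of the series for the balayage, followed by the others with
    one factor [I_L alpha] taken out. *)
Lemma balayage_fix x y : balayage alpha L x y =
  (\1_(~` L) x * (x == y)%:R)%:E +
  (\1_L x)%:E * dot (xmx alpha x) (balayage alpha L ^~ y).
Proof.
rewrite -dot_P => [|z]; last exact: balayage_ge0.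
rewrite {1}/balayage nneseries_recl// => [|k _]; last exact: Q_ge0.
rewrite [X in X + _]Q0; congr (_ + _).
rewrite dot_nneseries//; last by move=> k z; exact: Q_ge0.
rewrite -(@nneseries_addn _ (fun k => Q k x y) 1)//.
by apply: eq_eseriesr => k _; rewrite addn1 QS.
Qed.

Lemma balayageC x y : ~ L x -> balayage alpha L x y = (x == y)%:R%:E.
Proof.
move=> /ind_out[e1 e2]; rewrite balayage_fix e1 e2.
by rewrite mul1r mul0e adde0.
Qed.

(** At a point of [L] the balayage is harmonic, so one step of [alpha]
    changes nothing there; elsewhere cleaning is trivial. *)
Lemma cleaning_balayage (f : X -> R) x y :
  (forall x, 0 <= f x <= 1)%R -> (forall x, f x <= \1_L x)%R ->
  dot (cleaning alpha f x) (balayage alpha L ^~ y) = balayage alpha L x y.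
Proof.
move=> f01 fL; rewrite dot_cleaning// => [|z]; last exact: balayage_ge0.
case/andP: (f01 x) => f0 f1.
have [Lx|Lx] := pselect (L x); last first.
  have -> : f x = 0%R.
    by apply/eqP; rewrite eq_le f0 andbT -(ind_out Lx).1.
  by rewrite subr0 mul1e mul0e adde0.
have -> : dot (xmx alpha x) (balayage alpha L ^~ y) = balayage alpha L x y.
  rewrite [RHS]balayage_fix (ind_in Lx).1 (ind_in Lx).2.
  by rewrite mul0r mul1e add0e.
by rewrite -ge0_muleDl ?lee_fin ?subr_ge0// -EFinD subrK mul1e.
Qed.

Variable w : X -> R.
Hypothesis w0 : forall x, (0 <= w x)%R.
Hypothesis alpha_w : forall x, dot (xmx alpha x) (EFin \o w) <= (w x)%:E.

Let w0' x : 0 <= (EFin \o w) x. Proof. by rewrite lee_fin. Qed.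

Lemma cleaning_w (f : X -> R) x : (forall x, 0 <= f x <= 1)%R ->
  dot (cleaning alpha f x) (EFin \o w) <= (w x)%:E.
Proof.
move=> f01; case/andP: (f01 x) => f0 f1; rewrite dot_cleaning//.
apply: (@le_trans _ _ ((1 - f x)%:E * (w x)%:E + (f x)%:E * (w x)%:E)).
  by rewrite leeD2l// lee_wpmul2l.
by rewrite -!EFinM -EFinD -mulrDl subrK mul1r.
Qed.

(** Every partial sum of the series is bounded by [w]: if
    [Q_0 w + ... + Q_(n-1) w <= w], then
    [Q_0 w + ... + Q_n w <= I_(~ L) w + I_L alpha w <= w]. *)
Lemma balayage_w x : dot (balayage alpha L x) (EFin \o w) <= (w x)%:E.
Proof.
rewrite dotC dot_nneseries//; last by move=> k y; exact: Q_ge0.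
apply: lime_le.
  by apply: is_cvg_nneseries => k _ _; apply: dot_ge0 => // y; exact: Q_ge0.
apply: nearW => n; elim: n x => [|n IH] x; first by rewrite big_geq// lee_fin.
have Qw k y : 0 <= dot (EFin \o w) (Q k y) by exact: dot_ge0.
rewrite big_nat_recl//= -/(Q 0 x) (eq_dot (frefl _) (Q0 x)) dotC dot_diagl//.
under eq_bigr => k _.
  rewrite -/(Q k.+1 x) (eq_dot (frefl _) (QS k x)) dotC dotA//.
  rewrite (eq_dot (frefl _) (fun z => dotC (Q k z) (EFin \o w))).
  over.
rewrite -dot_sum//.
apply: (@le_trans _ _ ((\1_(~` L) x)%:E * (w x)%:E + dot (P x) (EFin \o w))).
  by rewrite leeD2l// le_dot// => y; exact: sume_ge0.
rewrite dot_P//.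
have [/ind_in[-> ->]|/ind_out[-> ->]] := pselect (L x).
  by rewrite mul0e mul1e add0e.
by rewrite mul0e mul1e adde0.
Qed.

End Balayage.
End Cleaning.

(** * The distance to the balayage *)

Section Residual.
Set Implicit Arguments.
Unset Strict Implicit.
Unset Printing Implicit Defensive.
Variables (R : realType) (X : choiceType).

Lemma wnormE (w : X -> R) (a : X -> \bar R) : (forall x, 0 <= a x) ->
  wnorm w a = dot a (EFin \o w).
Proof. by move=> a0; apply: eq_esum => x _; rewrite gee0_abs. Qed.

Lemma dot_lty (w : X -> R) (a : X -> \bar R) y : (forall x, 0 < w x)%R ->
  (forall x, 0 <= a x) -> dot a (EFin \o w) < +oo -> a y < +oo.
Proof.
move=> w0 a0 aw.
have : a y * (w y)%:E < +oo.
  apply: le_lt_trans aw; apply: esum_ge; exists [set y] => //.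
  by rewrite fsbig_set1.
by case: (a y) (a0 y) => [r _ _||] //; rewrite ?ltry// gt0_mulye ?lte_fin.
Qed.

(** The finiteness assumptions keep the signed sum defining the left-hand side
    from being of the form [+oo - +oo]. *)
Lemma xvec_mul_xsub (c : X -> R) (A B : X -> X -> \bar R) y :
  (forall x, 0 <= c x)%R ->
  (forall x y, 0 <= A x y) -> (forall x y, 0 <= B x y) ->
  (forall x, B x y < +oo) ->
  xvec_mul (EFin \o c) A y < +oo -> xvec_mul (EFin \o c) B y < +oo ->
  xvec_mul (EFin \o c) (xsub A B) y =
  xvec_mul (EFin \o c) A y - xvec_mul (EFin \o c) B y.
Proof.
move=> c0 A0 B0 Bfin; have c0' x : 0 <= (EFin \o c) x by rewrite lee_fin.
rewrite (xvec_mulE c0' A0) (xvec_mulE c0' B0) => Ay By.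
have summ (C : X -> X -> \bar R) : (forall x y, 0 <= C x y) ->
    dot (EFin \o c) (C ^~ y) < +oo ->
    summable [set: X] (fun x => (c x)%:E * C x y).
  move=> C0; rewrite /summable; congr (_ < _); apply: eq_esum => x _.
  by rewrite gee0_abs// mule_ge0// lee_fin.
have cM0 (C : X -> X -> \bar R) : (forall x y, 0 <= C x y) ->
    forall x, [set: X] x -> 0 <= (c x)%:E * C x y.
  by move=> C0 x _; rewrite mule_ge0// lee_fin.
rewrite -(esumB (summ A A0 Ay) (summ B B0 By) (cM0 A A0) (cM0 B B0)).
rewrite /xvec_mul (_ : (fun x => _) =
  (fun x => (c x)%:E * A x y) \- (fun x => (c x)%:E * B x y))//.
apply/funext => x; rewrite /= muleBr// fin_num_adde_defl// fin_numN.
by rewrite ge0_fin_numE.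
Qed.

Variables (alpha : X -> X -> R) (L : set X) (w : X -> R).
Hypothesis alpha_ge0 : forall x y, (0 <= alpha x y)%R.
Hypothesis w_gt0 : forall x, (0 < w x)%R.
Hypothesis alpha_w : forall x, dot (xmx alpha x) (EFin \o w) <= (w x)%:E.
Variable h : nat -> X -> R.
Hypothesis h01 : forall i x, (1 <= i)%N -> (0 <= h i x <= 1)%R.
Hypothesis hL : forall i x, (1 <= i)%N -> (h i x <= \1_L x)%R.
Variable c : X -> R.
Hypothesis c_ge0 : forall x, (0 <= c x)%R.
Hypothesis c_l1 : dot (EFin \o c) (EFin \o w) < +oo.

Let w0 x : (0 <= w x)%R. Proof. exact: ltW. Qed.
Let w0' x : 0 <= (EFin \o w) x. Proof. by rewrite lee_fin. Qed.
Let c0' x : 0 <= (EFin \o c) x. Proof. by rewrite lee_fin. Qed.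
Let s n := swept alpha h (EFin \o c) n.
Let Pi := balayage alpha L.
Let b_ge0 n x y : 0 <= cleaning alpha (h n.+1) x y.
Proof. by apply: cleaning_ge0 => // z; exact: h01. Qed.
Let s_ge0 n x : 0 <= s n x. Proof. exact: swept_ge0. Qed.
Let Pi_ge0 x y : 0 <= Pi x y. Proof. exact: balayage_ge0. Qed.

Definition residual n x : \bar R := s n x * (\1_L x)%:E.

Lemma residual_ge0 n x : 0 <= residual n x.
Proof. by rewrite mule_ge0// lee_fin indicE. Qed.

Lemma swept_w n : dot (s n) (EFin \o w) < +oo.
Proof.
elim: n => // n; apply: le_lt_trans => /=.
rewrite (eq_dot (xvec_mulE (s_ge0 n) (b_ge0 n)) (frefl _)) dotA//.
apply: le_dot => // x; first exact: dot_ge0.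
by apply: cleaning_w => // z; exact: h01.
Qed.

(** Each cleaning is absorbed by the balayage that follows it. *)
Lemma swept_balayage n : xvec_mul (s n) Pi = xvec_mul (EFin \o c) Pi.
Proof.
elim: n => // n <- /=; rewrite -xvec_mul_xmul//; congr xvec_mul.
apply/funext => x; apply/funext => y; rewrite xmulE//.
by apply: cleaning_balayage => // z; [exact: h01|exact: hL].
Qed.

Lemma swept_split n x : s n x = residual n x + s n x * (\1_(~` L) x)%:E.
Proof.
rewrite /residual -ge0_muleDr ?lee_fin ?indicE// in_setC -EFinD.
by case: (x \in L); rewrite ?addr0 ?add0r mule1.
Qed.

Lemma swept_balayage_residual n y :
  xvec_mul (s n) Pi y =
  dot (residual n) (Pi ^~ y) + s n y * (\1_(~` L) y)%:E.
Proof.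
have r0 := residual_ge0 n.
have o0 x : 0 <= s n x * (\1_(~` L) x)%:E by rewrite mule_ge0// lee_fin indicE.
rewrite xvec_mulE// (eq_dot (swept_split n) (frefl _)) dotDl//; congr (_ + _).
rewrite -(esum_delta y o0); apply: eq_esum => x _.
have [Lx|Lx] := pselect (L x); last by rewrite /Pi balayageC.
by rewrite indicE in_setC mem_set//= mule0 !mul0e.
Qed.

(** Outside [L] the swept vector is untouched by the balayage, so only its
    restriction to [L] contributes to the error: once directly and once through
    the balayage, with the same bound by [balayage_w]. *)
Lemma wnorm_residual n :
  wnorm w (xvec_mul (EFin \o c) (xsub (cleanings alpha h n) Pi)) <=
  dot (residual n) (EFin \o w) + dot (residual n) (EFin \o w).
Proof.
have r0 := residual_ge0 n.
have rPi0 y : 0 <= dot (residual n) (Pi ^~ y) by exact: dot_ge0.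
have r_le_s x : residual n x <= s n x.
  by rewrite [leRHS]swept_split leeDl// mule_ge0// lee_fin indicE.
have Piw x : dot (Pi x) (EFin \o w) <= (w x)%:E by exact: balayage_w.
have sPiw : dot (xvec_mul (s n) Pi) (EFin \o w) < +oo.
  rewrite (eq_dot (xvec_mulE (s_ge0 n) Pi_ge0) (frefl _)) dotA//.
  by apply: le_lt_trans (swept_w n); apply: le_dot => // x; exact: dot_ge0.
have diff y : xvec_mul (EFin \o c) (xsub (cleanings alpha h n) Pi) y =
    residual n y - dot (residual n) (Pi ^~ y).
  have sPi_fin := dot_lty y w_gt0 (xvec_mul_ge0 (s_ge0 n) Pi_ge0) sPiw.
  have s_fin := dot_lty y w_gt0 (s_ge0 n) (swept_w n).
  rewrite xvec_mul_xsub//; last 4 first.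
  - exact: cleanings_ge0.
  - move=> x; apply: (dot_lty y w_gt0 (Pi_ge0 x)).
    by rewrite (le_lt_trans (Piw x))// ltry.
  - by rewrite xvec_mul_cleanings.
  - by rewrite -(swept_balayage n).
  rewrite xvec_mul_cleanings// -(swept_balayage n) -/(s n) [s n y]swept_split.
  rewrite swept_balayage_residual.
  set o := s n y * _; have o_fin : o \is a fin_num.
    have o0 : 0 <= o by rewrite mule_ge0// lee_fin indicE.
    rewrite ge0_fin_numE// (le_lt_trans _ s_fin)// [leRHS]swept_split leeDr//.
  by rewrite fin_num_oppeD// addeACA subee// adde0.
apply: (@le_trans _ _ (\esum_(x in [set: X])
    (residual n x * (w x)%:E + dot (residual n) (Pi ^~ x) * (w x)%:E))).
  apply: le_esum => x _; rewrite diff -ge0_muleDl//.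
  apply: lee_wpmul2r; first exact: w0'.
  by rewrite (le_trans (lee_abs_sub _ _))// !gee0_abs.
rewrite esumD => [|x _|x _]; [|exact: mule_ge0 (r0 x) (w0' x)|
  exact: mule_ge0 (rPi0 x) (w0' x)].
rewrite leeD2l// -/(dot (fun x => dot (residual n) (Pi ^~ x)) (EFin \o w)).
by rewrite dotA// le_dot// => x; exact: dot_ge0.
Qed.

Let T := xmul (xmul (xdiag_set R L) (xmx alpha)) (xdiag_set R L).

Lemma restrictE x y :
  T x y = (\1_L x)%:E * (alpha x y)%:E * (\1_L y)%:E.
Proof.
have ind0 z : (0 <= \1_L z :> R)%R by rewrite indicE.
have alpha0 z t : 0 <= xmx alpha z t by rewrite lee_fin.
rewrite /T xmul_diagr// ?xmul_diagl//; apply: xmul_ge0 => // z t.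
exact: xdiag_ge0.
Qed.

Lemma residual_rec n y : residual n.+1 y =
  residual n y * (1 - h n.+1 y)%:E +
  dot (fun x => residual n x * (h n.+1 x)%:E) (T ^~ y).
Proof.
have hn x : (0 <= h n.+1 x <= 1)%R by exact: h01.
have alpha0 x z : 0 <= xmx alpha x z by rewrite lee_fin.
rewrite /residual.
rewrite -[s n.+1 y]/(xvec_mul (s n) (cleaning alpha (h n.+1)) y).
rewrite xvec_mul_cleaning//.
rewrite ge0_muleDl; last 2 first.
- by rewrite mule_ge0// lee_fin subr_ge0; case/andP: (hn y).
- by apply: dot_ge0 => // x; rewrite mule_ge0// lee_fin; case/andP: (hn x).
rewrite muleAC; congr (_ + _).
rewrite /dot -esumMr//; last first.
  by move=> x; rewrite !mule_ge0// lee_fin; case/andP: (hn x).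
apply: eq_esum => x _; rewrite restrictE.
(* Only points of [L] are moved, so restricting the source costs nothing. *)
have hI : (h n.+1 x)%:E = (\1_L x)%:E * (h n.+1 x)%:E * (\1_L x)%:E :> \bar R.
  have := hL x (isT : (1 <= n.+1)%N); have /andP[h0 _] := hn x; rewrite indicE.
  case: (x \in L) => hle; first by rewrite mul1e mule1.
  have -> : h n.+1 x = 0%R by apply/eqP; rewrite eq_le h0 hle.
  by rewrite mule0.
by rewrite [in LHS]hI /xmx !muleA.
Qed.

End Residual.

(** * Convergence of successive cleanings *)

Theorem theorem3p21 (R : realType) (X : countType)
  (X_nonempty : [set: X] !=set0)
  (alpha : X -> X -> R)
  (alpha_ge0 : forall x y : X, (0 <= alpha x y)%R)
  (w : X -> R)
  (w_gt0 : forall x : X, (0 < w x)%R)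
  (alpha_w : forall x : X, xmul_vec (xmx alpha) (EFin \o w) x <= (w x)%:E)
  (Lambda : set X)
  (h : nat -> X -> R)
  (h_01 : forall (i : nat) (x : X), (1 <= i)%N -> (0 <= h i x <= 1)%R)
  (h_Lambda : forall (i : nat) (x : X), (1 <= i)%N ->
     (0 <= h i x <= \1_Lambda x)%R)
  (h_infinite : forall x : X, Lambda x ->
     \sum_(1 <= i <oo) (h i x)%:E = +oo)
  (c : X -> R)
  (c_ge0 : forall x : X, (0 <= c x)%R)
  (c_l1 : wnorm w (EFin \o c) < +oo)
  (c_Lambda : (fun l : nat =>
     wnorm w (xvec_mul (EFin \o c)
       (xpow (xmul (xmul (xdiag_set R Lambda) (xmx alpha)) (xdiag_set R Lambda))
          l))) @ \oo --> 0) :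
  (fun N : nat =>
     wnorm w (xvec_mul (EFin \o c)
       (xsub (cleanings alpha h N) (balayage alpha Lambda)))) @ \oo --> 0.
Proof.
pose I := xdiag_set R Lambda; pose T := xmul (xmul I (xmx alpha)) I.
have w0 x : (0 <= w x)%R by exact: ltW.
have w0' x : 0 <= (EFin \o w) x by rewrite lee_fin.
have c0' x : 0 <= (EFin \o c) x by rewrite lee_fin.
have alpha0 x y : 0 <= xmx alpha x y by rewrite lee_fin.
have ind0 x : (0 <= \1_Lambda x :> R)%R by rewrite indicE.
have I0 : forall x y, 0 <= I x y by exact: xdiag_ge0.
have IA0 : forall x y, 0 <= xmul I (xmx alpha) x y by exact: xmul_ge0.
have T0 : forall x y, 0 <= T x y by exact: xmul_ge0.
have aw x : dot (xmx alpha x) (EFin \o w) <= (w x)%:E.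
  by rewrite -xsum_dot//; exact: alpha_w.
have cw : dot (EFin \o c) (EFin \o w) < +oo by rewrite -wnormE.
have hL i x : (1 <= i)%N -> (h i x <= \1_Lambda x)%R.
  by move=> i1; case/andP: (h_Lambda i x i1).
have ind_le1 x (z : \bar R) : 0 <= z -> (\1_Lambda x)%:E * z <= z.
  by rewrite indicE; case: (x \in Lambda); rewrite ?mul1e ?mul0e.
have Tw x : dot (T x) (EFin \o w) <= (w x)%:E.
  rewrite dot_xmul// dot_xmul// => [|y]; last exact: dot_ge0.
  rewrite dot_diagl// => [|y]; last by apply: dot_ge0 => // z; exact: dot_ge0.
  apply: le_trans (ind_le1 _ _ _) _.
    by apply: dot_ge0 => // z; exact: dot_ge0.
  apply: le_trans (aw x); apply: le_dot => // y; first exact: dot_ge0.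
  by rewrite dot_diagl// ind_le1.
pose a n := residual alpha Lambda h c n.
have a0 n x : 0 <= a n x by exact: residual_ge0.
have g_div x : (forall n, a n x = 0) \/ \sum_(0 <= k <oo) (h k.+1 x)%:E = +oo.
  have [Lx|Lx] := pselect (Lambda x); [right|left => n].
    rewrite -(h_infinite x Lx).
    (* Shifting the index needs nonnegative terms, and [h 0] is arbitrary. *)
    have -> : \sum_(1 <= i <oo) (h i x)%:E = \sum_(1 <= i <oo) (h i.-1.+1 x)%:E.
      rewrite eseries_cond [RHS]eseries_cond.
      by apply: eq_eseriesr => i /= i1; rewrite prednK.
    rewrite -(@nneseries_addn _ (fun k => (h k.-1.+1 x)%:E) 1) => [|k].
      by apply: eq_eseriesr => k _; rewrite addn1.
    by rewrite lee_fin; case/andP: (h_01 k.-1.+1 x isT).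
  by rewrite /a /residual indicE memNset// mule0.
have mass : dot (a 0%N) (EFin \o w) < +oo.
  apply: le_lt_trans cw; apply: le_dot => // x; rewrite /a /residual /= muleC.
  exact: ind_le1 (c0' x).
have tail : (fun l => dot (a 0%N) (potential T w l)) @ \oo --> 0.
  apply: squeeze_cvge (cvg_cst _) c_Lambda; apply: nearW => l.
  rewrite (dot_ge0 (a0 0%N) (potential_ge0 T0 w0 l))/= wnormE; last first.
    by apply: xvec_mul_ge0 => //; exact: xpow_ge0.
  rewrite (eq_dot (xvec_mulE c0' (xpow_ge0 l T0)) (frefl _)) dotA//; last first.
    exact: xpow_ge0.
  rewrite (eq_dot (frefl _) (dot_xpow T0 w0 l)).
  apply: le_dot (a0 0%N) (potential_ge0 T0 w0 l) _ (fun=> lexx _) => x.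
  by rewrite /a /residual /= muleC; exact: ind_le1 (c0' x).
have res0 : (fun n => dot (a n) (EFin \o w)) @ \oo --> 0.
  apply: (sandpile_cvg0 T0 w0 Tw _ a0 _ mass g_div tail) => n x.
    exact: h_01.
  exact: residual_rec.
apply: (@squeeze_cvge _ _ _ _ (cst 0) _
  (fun n => dot (a n) (EFin \o w) + dot (a n) (EFin \o w))).
- apply: nearW => n; apply/andP; split; last exact: wnorm_residual.
  by apply: esum_ge0 => x _; exact: mule_ge0 (abse_ge0 _) (w0' x).
- exact: cvg_cst.
- by rewrite -[X in _ --> X](adde0 0); apply: cvgeD.
Qed.
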